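(* Fix an integer $d\geq 2$, and let $M'_d(k)$ denote the number of vertices of the tree $\Xi_d(k)$. Then \[N_{[d]}^{\mathrm{non}}(k)\leq M'_d(k)=k^{\frac{1}{2}\log_2(k)(1+o(1))},\] where the inequality holds for all $k\geq 1$ and the $o(1)$ term tends to $0$ as $k\to\infty$ (with $d$ fixed).
   Context: Let $d\geq 2$ be an integer. A $[d]$-tree is a rooted tree in which the children of each vertex are linearly ordered from left to right and the number of children of each vertex is an element of $\{0,1,\dots,d\}$. Noncontiguous containment. Let $e$ be an edge in a $[d]$-tree that connects a vertex $u$ to one of its children $v$. If the total number of children of $u$ and $v$, excluding $v$ itself, is at most $d$, then contracting $e$ is a legal contraction; in the contracted tree, the children of $v$ take the place of $v$ in the ordered list of children of $u$ (so children of $u$ to the left, respectively right, of $v$ remain to the left, respectively right, of the children of $v$). A $[d]$-tree $\mathcal T$ noncontiguously contains a $[d]$-tree $T$ if $T$ can be obtained from $\mathcal T$ by a (possibly empty) sequence of legal edge contractions. $N_{[d]}^{\mathrm{non}}(k)$ denotes the minimum number of vertices in a $[d]$-tree that noncontiguously contains every $[d]$-tree with $k$ vertices. Gluing. To glue a tree $T'$ to a leaf $v$ of a tree $T$ means to attach $T'$ to $T$ by identifying the root of $T'$ with $v$. Building blocks. If $d>2$, the modified $d$-vertebra is the $[d]$-tree on $4$ vertices in which the root has $3$ children; its left, center and right leaves are these children from left to right. The modified $2$-vertebra is the $[2]$-tree with $5$ vertices in which the root has $2$ children and the left child of the root has $2$ children; its left, center and right leaves are its three leaves from left to right. For $m\geq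 1$, the $m$-th $d$-spine is obtained by consecutively gluing $m$ copies of the modified $d$-vertebra under a path on $2$ vertices: the first copy is glued to the leaf of the path, and each subsequent copy is glued to the center leaf of the previous copy. The vertebrae are numbered first, second, etc., from the top down. The trees $\Xi_d(k)$. $\Xi_d(1)$ is a single vertex; $\Xi_d(2)$ is the path on $2$ vertices; $\Xi_d(3)$ is obtained from the path on $2$ vertices by giving the bottom vertex $2$ children. If $d=2$ and $k\geq 4$, then $\Xi_2(k)$ is obtained from the $(\lfloor k/2\rfloor-1)$-th $2$-spine as follows: (1) for each $1\leq i\leq\lfloor k/2\rfloor-2$, glue a copy of $\Xi_2(i)$ to each of the left and right leaves of the $i$-th modified $2$-vertebra; (2) glue a copy of $\Xi_2(\lfloor k/2\rfloor-1)$ to the right leaf of the $(\lfloor k/2\rfloor-1)$-th (lowest) modified $2$-vertebra; (3) glue a copy of $\Xi_2(\lceil k/2\rceil-1)$ to the left leaf of the $(\lfloor k/2\rfloor-1)$-th modified $2$-vertebra; (4) glue a copy of $\Xi_2(\lceil k/2\rceil)$ to the center leaf of the $(\lfloor k/2\rfloor-1)$-th modified $2$-vertebra. If $d>2$ and $k\geq 4$, then $\Xi_d(k)$ is obtained from the $\lfloor k/2\rfloor$-th $d$-spine as follows: (1) for each $1\leq i\leq\lfloor k/2\rfloor-2$, glue a copy of $\Xi_d(i)$ to each of the left and right leaves of the $i$-th modified $d$-vertebra; (2) glue a copy of $\Xi_d(\lfloor k/2\rfloor-1)$ to the right leaf of the $(\lfloor k/2\rfloor-1)$-th (second-lowest)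 modified $d$-vertebra; (3) glue a copy of $\Xi_d(\lceil k/2\rceil-1)$ to the left leaf of the $(\lfloor k/2\rfloor-1)$-th modified $d$-vertebra; (4) glue a copy of $\Xi_d(\lceil k/2\rceil)$ to the center leaf of the $\lfloor k/2\rfloor$-th (lowest) modified $d$-vertebra; (5) glue a copy of $\Xi_d(\lfloor (k+1)/4\rfloor)$ to each of the left and right leaves of the $\lfloor k/2\rfloor$-th modified $d$-vertebra. *)

(* Defs.v *)
From mathcomp Require Import all_boot all_order all_algebra.
From mathcomp Require Import all_classical all_reals all_analysis.
From mathcomp Require Import zify.
From Stdlib Require Import Relation_Operators.

Set Implicit Arguments.
Unset Strict Implicit.
Unset Printing Implicit Defensive.

Import numFieldNormedType.Exports.
Local Open Scope nat_scope.

(* Rooted plane trees: [Node ts] is a root whose children, from left to right,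
   are the roots of the trees in [ts]. *)
Inductive tree := Node of seq tree.

Definition children (t : tree) : seq tree := let: Node ts := t in ts.

Definition leaf : tree := Node [::].

Fixpoint nverts (t : tree) : nat :=
  let: Node ts := t in (sumn (map nverts ts)).+1.

Fixpoint dtree (d : nat) (t : tree) : bool :=
  let: Node ts := t in (size ts <= d) && all (dtree d) ts.

(* In [contract_root], u is the root and v is the child [Node c]; in
   [contract_below], the contracted edge lies inside a child subtree. *)
Inductive contract (d : nat) : tree -> tree -> Prop :=
| contract_root (l c r : seq tree) :
    size l + size c + size r <= d ->
    contract d (Node (l ++ Node c :: r)) (Node (l ++ c ++ r))
| contract_below (l r : seq tree) (t t' : tree) :
    contract d t t' ->
    contract d (Node (l ++ t :: r)) (Node (l ++ t' :: r)).

Definition noncontiguously_contains (d : nat) (U T : tree) : Prop :=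
  clos_refl_trans tree (contract d) U T.

Definition universal (d k : nat) (U : tree) : Prop :=
  dtree d U /\
  forall T, dtree d T -> nverts T = k -> noncontiguously_contains d U T.

(* The graph of the function k |-> N_[d]^non(k): a relation, so that no default
   value is needed before a universal tree is known to exist. *)
Definition is_Nnon (d k N : nat) : Prop :=
  (exists2 U, universal d k U & nverts U = N) /\
  forall U, universal d k U -> N <= nverts U.

(* A vertex is addressed by the list of child indices, counted from 0, leading
   to it from the root.  When [a] is the address of a leaf of [T], identifying
   that leaf with the root of [T'] amounts to replacing it by [T']. *)
Fixpoint glue (T : tree) (a : seq nat) (T' : tree) : tree :=
  if a is i :: a' then
    Node (set_nth leaf (children T) i (glue (nth leaf (children T) i) a' T'))
  else T'.

(* Only meant for d >= 2, as are the leaf addresses below. *)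
Definition vertebra (d : nat) : tree :=
  if d == 2 then Node [:: Node [:: leaf; leaf]; leaf]
  else Node [:: leaf; leaf; leaf].

Definition left_leaf (d : nat) : seq nat := if d == 2 then [:: 0; 0] else [:: 0].
Definition center_leaf (d : nat) : seq nat := if d == 2 then [:: 0; 1] else [:: 1].
Definition right_leaf (d : nat) : seq nat := if d == 2 then [:: 1] else [:: 2].

(* Address, in a spine, of the root of the i-th vertebra (i >= 1). *)
Definition vroot (d i : nat) : seq nat :=
  0 :: flatten (nseq i.-1 (center_leaf d)).

Fixpoint spine (d m : nat) : tree :=
  if m is m'.+1 then glue (spine d m') (vroot d m) (vertebra d)
  else Node [:: leaf].

Definition glue_left (d i : nat) (T T' : tree) : tree :=
  glue T (vroot d i ++ left_leaf d) T'.
Definition glue_center (d i : nat) (T T' : tree) : tree :=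
  glue T (vroot d i ++ center_leaf d) T'.
Definition glue_right (d i : nat) (T T' : tree) : tree :=
  glue T (vroot d i ++ right_leaf d) T'.

(* One step of the recursion defining Xi_d, where [X i] stands for Xi_d(i). *)
Definition Xi_step (d : nat) (X : nat -> tree) (k : nat) : tree :=
  match k with
  | 0 | 1 => leaf
  | 2 => Node [:: leaf]
  | 3 => Node [:: Node [:: leaf; leaf]]
  | _ =>
    let h := k./2 in
    let T0 := spine d (if d == 2 then h.-1 else h) in
    let T1 := foldl (fun T i => glue_right d i (glue_left d i T (X i)) (X i))
                    T0 (iota 1 (h - 2)) in
    let T2 := glue_right d h.-1 T1 (X h.-1) in
    let T3 := glue_left d h.-1 T2 (X (uphalf k).-1) in
    if d == 2 then glue_center d h.-1 T3 (X (uphalf k))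
    else
      let T4 := glue_center d h T3 (X (uphalf k)) in
      let T5 := glue_left d h T4 (X (k.+1 %/ 4)) in
      glue_right d h T5 (X (k.+1 %/ 4))
  end.

(* [n] is fuel; it suffices that k <= n, see [XiE]. *)
Fixpoint Xi_fuel (d n k : nat) : tree :=
  if n is n'.+1 then Xi_step d (Xi_fuel d n') k else leaf.

(* Junk value [leaf] at k = 0. *)
Definition Xi (d k : nat) : tree := Xi_fuel d k k.

Lemma eq_Xi_step (d k : nat) (X Y : nat -> tree) :
  (forall i, i < k -> X i = Y i) -> Xi_step d X k = Xi_step d Y k.
Proof.
case: k => [|[|[|[|k]]]] // XY; rewrite /Xi_step.
have lt1 : (k.+4)./2 < k.+4 by rewrite ltn_half_double -addnn; lia.
have lt2 : uphalf k.+4 < k.+4.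
  by rewrite uphalfE ltn_half_double -addnn; lia.
have lt3 : k.+4.+1 %/ 4 < k.+4 by rewrite ltn_divLR //; lia.
rewrite !XY //; [|exact: leq_ltn_trans (leq_pred _) _..].
suff -> : forall T0, foldl (fun T i => glue_right d i (glue_left d i T (X i)) (X i))
    T0 (iota 1 ((k.+4)./2 - 2)) =
  foldl (fun T i => glue_right d i (glue_left d i T (Y i)) (Y i))
    T0 (iota 1 ((k.+4)./2 - 2)) by [].
have : {in iota 1 ((k.+4)./2 - 2), forall i, X i = Y i}.
  by move=> i; rewrite mem_iota => /andP[_ ilt]; apply: XY; lia.
elim: (iota _ _) => //= i s IHs XYs T0.
by rewrite XYs ?mem_head // IHs // => j js; rewrite XYs // inE js orbT.
Qed.

Lemma XiE (d k : nat) : Xi d k = Xi_step d (Xi d) k.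
Proof.
have fuelE n m i : i <= n -> i <= m -> Xi_fuel d n i = Xi_fuel d m i.
  elim: n m i => [|n IHn] [|m] i //=; try by case: i.
  by move=> lein leim; apply: eq_Xi_step => j ltji; apply: IHn; lia.
rewrite /Xi; case: k => [//|k].
by apply: eq_Xi_step => i ltik; apply: fuelE.
Qed.

Definition Mprime (d k : nat) : nat := nverts (Xi d k).

Definition log2 (R : realType) (x : R) : R := (ln x / ln 2)%R.

(* Main.v *)
Require Import Defs.
From mathcomp Require Import all_boot all_order all_algebra.
From mathcomp Require Import all_classical all_reals all_analysis.
From mathcomp Require Import zify ring lra.
From Stdlib Require Import Relation_Operators.

Set Implicit Arguments.
Unset Strict Implicit.
Unset Printing Implicit Defensive.

Import numFieldNormedType.Exports.

(** Both halves rest on one picture of Xi_d(k): for k >= 4 it is an edge above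
    a chain of vertebrae, the i-th of which carries a copy of Xi_d(i) on either
    side, with Xi_d of uphalf k at the bottom ([Xi_lspine]).

    Universality is proved by strong induction on k.  Write h = k./2,
    n = h - 1 and K = uphalf k.  Contracting the edge to a center leaf merges a
    vertebra into the vertex above it, so consecutive vertebrae can be turned
    into a single vertex with many children: the trees hosted on the left
    sides appear from left to right, those on the right sides from right to
    left, and what the bottom provides comes between ([vstack_contains]).  A
    tree of size s can be hosted by any vertebra numbered at least s, and
    placing trees greedily never uses more vertebrae than their total size
    ([hosts_iota]).  Given a tree T, descend from its root towards the child
    with more than K vertices as long as there is one.  The subtrees left
    aside are paid for by their own sizes, so fewer than n vertebrae are used
    ([lspine_contains]).  At the end every child has at most K vertices.  Host
    on the left the longest initial run of children with total size at most
    the number of remaining vertebrae; the next child then goes on the left of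
    vertebra n, where the larger tree Xi_d(K - 1) hangs, and the others have
    fewer than K vertices in total, hence fit at the bottom as a forest.  This
    can fail only when the sizes are tight, and then one child at the bottom,
    on the right of vertebra n, or on the extra lowest vertebra settles it
    ([lspine_light]).

    For the asymptotics, let M(k) be the number of vertices of Xi_d(k).  The
    construction gives M(k) >= M(0) + ... + M(h), which iterates to
    (k + 1)^j <= j! 2^(j(j+1)/2) M(k) for every j ([Mprime_lower]), and
    bounding every copy by the largest gives M(k) <= 2^(j(j-1)/2 + 3j) for
    k <= 2^j ([Mprime_upper]).  Taking j close to log2 k, both sides
    are 2^((log2 k)^2/2) up to an error of order
    log2 k * log2 (log2 k) in the exponent, which is absorbed by o(1). *)

Local Open Scope nat_scope.

(** * Containment and forests *)

Notation "U ~>[ d ] T" := (noncontiguously_contains d U T)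
  (at level 70, d at level 0, T at next level).

Definition fsize (ts : seq tree) : nat := sumn (map nverts ts).

Lemma fsize_cat ts us : fsize (ts ++ us) = fsize ts + fsize us.
Proof. by rewrite /fsize map_cat sumn_cat. Qed.

Lemma fsize_cons t ts : fsize (t :: ts) = nverts t + fsize ts.
Proof. by []. Qed.

Lemma fsize_nil : fsize [::] = 0.
Proof. by []. Qed.

Lemma fsize_rev ts : fsize (rev ts) = fsize ts.
Proof. by rewrite /fsize map_rev sumn_rev. Qed.

Lemma nvertsE ts : nverts (Node ts) = (fsize ts).+1.
Proof. by []. Qed.

Lemma nverts_gt0 t : 0 < nverts t.
Proof. by case: t. Qed.

Lemma dtreeE d ts : dtree d (Node ts) = (size ts <= d) && all (dtree d) ts.
Proof. by []. Qed.

Lemma contains_refl d T : T ~>[d] T.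
Proof. exact: rt_refl. Qed.

Lemma contains_trans d U V W : U ~>[d] V -> V ~>[d] W -> U ~>[d] W.
Proof. exact: rt_trans. Qed.

Lemma contains_below d l r U T :
  U ~>[d] T -> Node (l ++ U :: r) ~>[d] Node (l ++ T :: r).
Proof.
elim=> [{}U {}T UT|{}U|{}U V {}T _ IH1 _ IH2].
- by apply: rt_step; apply: contract_below.
- exact: contains_refl.
- exact: contains_trans IH1 IH2.
Qed.

(** Contracting below a vertex and then contracting the edge to that child
    splices a list of trees into the list of its siblings.  Tracking what a
    child can be spliced into, rather than what it contains, treats hosting a
    single tree and supplying a forest alike. *)
Definition yields (d : nat) (U : tree) (ts : seq tree) : Prop :=
  forall l r, size l + size ts + size r <= d ->
    Node (l ++ U :: r) ~>[d] Node (l ++ ts ++ r).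

Lemma yields1 d U T : U ~>[d] T -> yields d U [:: T].
Proof. by move=> UT l r _; apply: contains_below. Qed.

Lemma yields_forest d U ts : U ~>[d] Node ts -> yields d U ts.
Proof.
move=> UT l r le_d; apply: contains_trans (contains_below l r UT) _.
by apply: rt_step; apply: contract_root.
Qed.

(** The edge above a leaf can always be contracted, so a tree can be pruned
    leaf by leaf. *)
Lemma contains_leaf d U : dtree d U -> U ~>[d] leaf.
Proof.
have [n] := ubnP (nverts U); elim: n U => // n IHn [[|t ts]] lt_n.
  by move=> _; apply: contains_refl.
rewrite dtreeE /= => /andP[le_d /andP[dt dts]].
rewrite nvertsE fsize_cons in lt_n; have tpos := nverts_gt0 t.
have tl : t ~>[d] leaf by apply: IHn => //; lia.
apply: contains_trans (yields_forest tl (l := [::]) (r := ts) _) _.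
  by rewrite /=; lia.
by apply: IHn; rewrite /= ?dts ?andbT -?/(fsize _); lia.
Qed.

(** A modified vertebra with trees glued to its left, center and right leaves. *)
Definition vert (d : nat) (L C R : tree) : tree :=
  if d == 2 then Node [:: Node [:: L; C]; R] else Node [:: L; C; R].

(** The order of the contractions matters, since no vertex may get more than
    [d] children on the way: the sides come first, as they contribute at most
    one tree each.  For [d = 2] the inner edge of the vertebra goes last. *)
Lemma vert_contains d L C R ls ts rs : 2 <= d ->
  yields d L ls -> yields d C ts -> yields d R rs ->
  size ls <= 1 -> size rs <= 1 -> size (ls ++ ts ++ rs) <= d ->
  vert d L C R ~>[d] Node (ls ++ ts ++ rs).
Proof.
rewrite !size_cat => d2 Ll Ct Rr l1 r1 le_d; rewrite /vert; case: eqP => d_eq2.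
  have step1 : Node [:: Node [:: L; C]; R] ~>[d] Node (Node [:: L; C] :: rs).
    by have := Rr [:: Node [:: L; C]] [::]; rewrite /= cats0; apply; lia.
  have step2 : Node [:: L; C] ~>[d] Node (ls ++ [:: C]).
    by apply: (Ll [::] [:: C]) => /=; lia.
  have step3 : Node (ls ++ [:: C]) ~>[d] Node (ls ++ ts).
    by have := Ct ls [::]; rewrite !cats0 /=; apply; lia.
  apply: contains_trans step1 _; rewrite catA.
  apply: (yields_forest (contains_trans step2 step3) (l := [::])).
  by rewrite size_cat /=; lia.
have step1 : Node [:: L; C; R] ~>[d] Node (ls ++ [:: C; R]).
  by apply: (Ll [::] [:: C; R]) => /=; lia.
have step2 : Node (ls ++ [:: C; R]) ~>[d] Node (ls ++ C :: rs).
  have := Rr (ls ++ [:: C]) [::]; rewrite cats0 -!catA /=; apply.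
  by rewrite size_cat /=; lia.
apply: contains_trans step1 (contains_trans step2 _).
by apply: Ct; lia.
Qed.

(** The trees [ts] can be obtained in order from the trees [Us], each from its
    own host and with the remaining hosts pruned away. *)
Inductive hosts (d : nat) : seq tree -> seq tree -> Prop :=
| hosts_nil : hosts d [::] [::]
| hosts_skip U Us ts :
    U ~>[d] leaf -> hosts d Us ts -> hosts d (U :: Us) ts
| hosts_take U Us t ts :
    U ~>[d] t -> hosts d Us ts -> hosts d (U :: Us) (t :: ts).

Lemma hosts_cons_inv d U Us ts : hosts d (U :: Us) ts ->
  exists ts1 ts2, [/\ ts = ts1 ++ ts2, size ts1 <= 1, yields d U ts1
                    & hosts d Us ts2].
Proof.
move=> H; inversion H as [|U' Us' ts' Ul Hts|U' Us' t ts' Ut Hts]; subst.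
- by exists [::], ts; split=> //; apply: yields_forest.
- by exists [:: t], ts'; split=> //; apply: yields1.
Qed.

Lemma hosts_cat d Us1 Us2 ts1 ts2 :
  hosts d Us1 ts1 -> hosts d Us2 ts2 -> hosts d (Us1 ++ Us2) (ts1 ++ ts2).
Proof.
move=> H1 H2; elim: H1 => //= U Us *; [exact: hosts_skip|exact: hosts_take].
Qed.

Definition universal_le (d n : nat) (U : tree) : Prop :=
  forall T, dtree d T -> nverts T <= n -> U ~>[d] T.

Lemma universal_le_leaf d n U : 0 < n -> universal_le d n U -> U ~>[d] leaf.
Proof. by move=> n0; apply. Qed.

Lemma universal_le_yields d n U ts : universal_le d n U ->
  size ts <= d -> all (dtree d) ts -> fsize ts < n -> yields d U ts.
Proof.
move=> HU sz dts lt; apply: yields_forest; apply: HU => //.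
by rewrite dtreeE sz.
Qed.

(** The sum estimates the last vertebra that the greedy placement uses: a first
    tree of size s goes to vertebra [maxn c.+1 s], and each later one costs at
    most its size.  Unlike a bound on the total size alone, this one survives
    skipping vertebra [c.+1] when the first tree is too large for it. *)
Lemma hosts_iota_greedy d (U : nat -> tree) c n ts :
  (forall i, c < i <= c + n -> universal_le d i (U i)) ->
  all (dtree d) ts ->
  (if ts is t :: ts' then maxn c.+1 (nverts t) + fsize ts' <= c + n else true) ->
  hosts d (map U (iota c.+1 n)) ts.
Proof.
elim: n c ts => [|n IHn] c ts HU dts.
  by case: ts {dts} => [_|t ts]; [exact: hosts_nil|lia].
have HU' i : c.+1 < i <= c.+1 + n -> universal_le d i (U i).
  by move=> ?; apply: HU; lia.
have HUc : universal_le d c.+1 (U c.+1) by apply: HU; lia.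
case: ts dts => [_ _|t ts] /=.
  apply: hosts_skip; first exact: universal_le_leaf HUc.
  exact: IHn.
case/andP=> dt dts le_n; case: (leqP (nverts t) c.+1) => [le_t|lt_t].
  apply: hosts_take; first exact: HUc.
  apply: IHn => //; case: ts dts le_n => // t' ts dts.
  by rewrite fsize_cons; have := nverts_gt0 t'; lia.
apply: hosts_skip; first exact: universal_le_leaf HUc.
by apply: IHn; rewrite //= ?dt //; lia.
Qed.

Lemma hosts_iota d (U : nat -> tree) c n ts :
  (forall i, c < i <= c + n -> universal_le d i (U i)) ->
  all (dtree d) ts -> fsize ts <= n -> hosts d (map U (iota c.+1 n)) ts.
Proof.
move=> HU dts le_n; apply: hosts_iota_greedy => //.
by case: ts le_n {dts} => // t ts; rewrite fsize_cons; have := nverts_gt0 t; lia.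
Qed.

(** The chain of vertebrae without the edge above it, the pairs listing from
    the top down the trees glued on the left and on the right. *)
Definition vstack (d : nat) (ps : seq (tree * tree)) (C : tree) : tree :=
  foldr (fun p T => vert d p.1 T p.2) C ps.

Lemma vert_stack_contains d p Ls Rs W ls ts rs : 2 <= d ->
  hosts d (p.1 :: Ls) ls -> hosts d (p.2 :: Rs) rs ->
  (forall ls' rs', hosts d Ls ls' -> hosts d Rs rs' ->
     yields d W (ls' ++ ts ++ rev rs')) ->
  size (ls ++ ts ++ rev rs) <= d ->
  vert d p.1 W p.2 ~>[d] Node (ls ++ ts ++ rev rs).
Proof.
move=> d2 /hosts_cons_inv[l1 [l2 [-> sl1 Yl Hl]]].
move=> /hosts_cons_inv[r1 [r2 [-> sr1 Yr Hr]]] HW.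
have -> : (l1 ++ l2) ++ ts ++ rev (r1 ++ r2) = l1 ++ (l2 ++ ts ++ rev r2) ++ r1.
  by rewrite rev_cat -!catA; case: r1 sr1 {Yr} => [|x []].
by apply: vert_contains => //; apply: HW.
Qed.

Lemma vstack_yields d ps C ls ts rs : 2 <= d ->
  hosts d (map fst ps) ls -> hosts d (map snd ps) rs -> yields d C ts ->
  yields d (vstack d ps C) (ls ++ ts ++ rev rs).
Proof.
move=> d2; elim: ps ls rs => [|p ps IHps] ls rs /= Hl Hr HC.
  by inversion Hl; inversion Hr; rewrite cats0.
move=> l r le_d.
have le_d' : size (ls ++ ts ++ rev rs) <= d by lia.
apply: (yields_forest _ le_d).
by apply: vert_stack_contains Hl Hr _ le_d' => // ls' rs' *; apply: IHps.
Qed.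

(** The right sides are listed from the top down, and merging vertebrae puts
    the higher ones further out; hence the reversal. *)
Lemma vstack_contains d ps C ls ts rs : 2 <= d -> 0 < size ps ->
  hosts d (map fst ps) ls -> hosts d (map snd ps) rs -> yields d C ts ->
  size (ls ++ ts ++ rev rs) <= d ->
  vstack d ps C ~>[d] Node (ls ++ ts ++ rev rs).
Proof.
case: ps => // p ps d2 _ Hl Hr HC le_d.
by apply: vert_stack_contains Hl Hr _ le_d => // ls' rs' *; apply: vstack_yields.
Qed.

(** * Hosting a tree on a loaded spine *)

(** What universality uses about the trees glued to the spine when [n] is
    the number of vertebrae with a copy for each index and [K] bounds the trees
    at the bottom.  The last of these vertebrae may have a larger tree on its
    left; [tl] is the extra lowest vertebra, absent from Xi_2. *)
Record loaded (d n K : nat) (UL UR : nat -> tree) (tl : seq (tree * tree))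
    (C : tree) : Prop := Loaded {
  loaded_d : 2 <= d;
  loaded_K : n < K <= n.+2;
  loaded_left : forall i, 0 < i <= n -> universal_le d i (UL i);
  loaded_right : forall i, 0 < i <= n -> universal_le d i (UR i);
  loaded_left_last : universal_le d K.-1 (UL n);
  loaded_center : universal_le d K C;
  loaded_tail : d = 2 /\ tl = [::] \/
    exists Q Q', [/\ tl = [:: (Q, Q')], Q ~>[d] leaf & Q' ~>[d] leaf] }.

(** The part of a loaded spine strictly below vertebra [c] is what is left
    once [c] vertebrae have been used. *)
Definition lspine d n (UL UR : nat -> tree) tl C c : tree :=
  vstack d ([seq (UL i, UR i) | i <- iota c.+1 (n - c)] ++ tl) C.

Lemma lspine_split d n UL UR tl C c s : c + s <= n ->
  lspine d n UL UR tl C c =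
  vstack d [seq (UL i, UR i) | i <- iota c.+1 s]
    (lspine d n UL UR tl C (c + s)).
Proof.
move=> le_n; rewrite /lspine (_ : n - c = s + (n - (c + s))); last by lia.
by rewrite iotaD map_cat -catA /vstack foldr_cat addSn.
Qed.

Lemma map_fst_pairs (UL UR : nat -> tree) s :
  map fst [seq (UL i, UR i) | i <- s] = map UL s.
Proof. by rewrite -map_comp. Qed.

Lemma map_snd_pairs (UL UR : nat -> tree) s :
  map snd [seq (UL i, UR i) | i <- s] = map UR s.
Proof. by rewrite -map_comp. Qed.

Lemma greedy_prefix r ts : fsize ts <= r \/
  exists A x D, [/\ ts = A ++ x :: D, fsize A <= r & r < fsize A + nverts x].
Proof.
elim: ts r => [|t ts IHts] r; first by left.
case: (leqP (nverts t) r) => [le_t|lt_t]; last by right; exists [::], t, ts.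
have [le_r|[A [x [D [-> le_A lt_A]]]]] := IHts (r - nverts t).
  by left; rewrite fsize_cons; lia.
by right; exists (t :: A), x, D; split=> //; rewrite fsize_cons; lia.
Qed.

Lemma light_or_heavy K ts : all (fun t => nverts t <= K) ts \/
  exists A y B, ts = A ++ y :: B /\ K < nverts y.
Proof.
elim: ts => [|t ts [IH|[A [y [B [-> lt]]]]]]; first by left.
  case: (leqP (nverts t) K) => lt; last by right; exists [::], t, ts.
  by left; rewrite /= lt IH.
by right; exists (t :: A), y, B.
Qed.

Lemma nverts1 T : nverts T = 1 -> T = leaf.
Proof.
case: T => -[//|t ts]; rewrite nvertsE fsize_cons.
by have := nverts_gt0 t; lia.
Qed.

Lemma lspine_place d n K UL UR tl C c ls ts rs :
  loaded d n K UL UR tl C -> c < n ->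
  hosts d (map UL (iota c.+1 (n - c)) ++ map fst tl) ls ->
  hosts d (map UR (iota c.+1 (n - c)) ++ map snd tl) rs ->
  yields d C ts -> size (ls ++ ts ++ rev rs) <= d ->
  lspine d n UL UR tl C c ~>[d] Node (ls ++ ts ++ rev rs).
Proof.
move=> H lt_cn Hl Hr HC le_d; apply: vstack_contains => //.
- exact: loaded_d H.
- by rewrite size_cat size_map size_iota; lia.
- by rewrite map_cat map_fst_pairs.
- by rewrite map_cat map_snd_pairs.
Qed.

Lemma hosts_tail d n K UL UR tl C : loaded d n K UL UR tl C ->
  hosts d (map fst tl) [::] /\ hosts d (map snd tl) [::].
Proof.
move=> H; case: (loaded_tail H) => [[_ ->]|[Q [Q' [-> HQ HQ']]]] /=.
  by split; apply: hosts_nil.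
by split; apply: hosts_skip => //; apply: hosts_nil.
Qed.

Lemma hosts_iota_last d (U : nat -> tree) c n m ts x :
  c < n -> (forall i, 0 < i <= n -> universal_le d i (U i)) ->
  universal_le d m (U n) -> all (dtree d) ts -> dtree d x ->
  fsize ts < n - c -> nverts x <= m ->
  hosts d (map U (iota c.+1 (n - c))) (ts ++ [:: x]).
Proof.
move=> lt_cn HU Hn dts dx lt_ts le_x.
rewrite (_ : n - c = (n - c.+1) + 1); last by lia.
rewrite iotaD map_cat; apply: hosts_cat.
  by apply: hosts_iota => // [i ?|]; [apply: HU|]; lia.
rewrite (_ : c.+1 + _ = n); last by lia.
by apply: hosts_take; [exact: Hn|exact: hosts_nil].
Qed.

(** The heart of the argument: a vertex all of whose subtrees have size at most
    [K] can be made from the remaining vertebrae.  The bound on [fsize ts] says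
    that, after a run of total size more than [n - c], fewer than [K] vertices
    remain, so that the bottom can supply them all as a forest. *)
Lemma lspine_light d n K UL UR tl C c ts :
  loaded d n K UL UR tl C -> c < n ->
  size ts <= d -> all (dtree d) ts -> all (fun t => nverts t <= K) ts ->
  fsize ts <= K + (n - c) ->
  lspine d n UL UR tl C c ~>[d] Node ts.
Proof.
move=> H lt_cn le_d dts le_K le_ts.
have [tlL tlR] := hosts_tail H; have [K1 K2] := andP (loaded_K H).
have HL ls : all (dtree d) ls -> fsize ls <= n - c ->
    hosts d (map UL (iota c.+1 (n - c))) ls.
  by move=> *; apply: hosts_iota => // i ?; apply: (loaded_left H); lia.
have HR rs : all (dtree d) rs -> fsize rs <= n - c ->
    hosts d (map UR (iota c.+1 (n - c))) rs.
  by move=> *; apply: hosts_iota => // i ?; apply: (loaded_right H); lia.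
have C1 x : dtree d x -> nverts x <= K -> yields d C [:: x].
  by move=> *; apply: yields1; apply: (loaded_center H).
have CF us : size us <= d -> all (dtree d) us -> fsize us < K -> yields d C us.
  by move=> *; apply: universal_le_yields (loaded_center H) _ _ _.
have place ls us rs :
    hosts d (map UL (iota c.+1 (n - c))) ls ->
    hosts d (map UR (iota c.+1 (n - c))) rs ->
    yields d C us -> size (ls ++ us ++ rev rs) <= d ->
    lspine d n UL UR tl C c ~>[d] Node (ls ++ us ++ rev rs).
  move=> Hl Hr; apply: (lspine_place H) => //.
    by rewrite -[ls]cats0; apply: hosts_cat.
  by rewrite -[rs]cats0; apply: hosts_cat.
have [le_r|[A [x [D [def_ts le_A lt_A]]]]] := greedy_prefix (n - c) ts.
  have := place ts [::] [::] (HL _ dts le_r) (HR [::] isT isT).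
  by rewrite /= cats0; apply=> //; apply: CF; rewrite // /fsize /=; lia.
move: le_d dts le_K le_ts; rewrite {ts}def_ts size_cat /= !all_cat /=.
rewrite fsize_cat fsize_cons => le_d /and3P[dA dx dD] /and3P[KA Kx KD] le_ts.
have [eq_x|ne_x] := eqVneq (nverts x) K.
  (* The other trees have total size at most [n - c], so [x] can be central. *)
  have := place A [:: x] (rev D); rewrite revK /=; apply.
  - by apply: HL.
  - by apply: HR; rewrite ?all_rev // fsize_rev; lia.
  - exact: C1.
  - by rewrite size_cat /=; lia.
have [lt_A'|ge_A] := ltnP (fsize A) (n - c).
  (* The left of vertebra [n] is still free, and takes any tree of size less
     than [K]; what follows [x] goes to the bottom. *)
  have := place (A ++ [:: x]) D [::]; rewrite /= cats0 -catA /=; apply.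
  - apply: (@hosts_iota_last _ _ _ _ K.-1) => //; try by lia.
    + exact: loaded_left H.
    + exact: loaded_left_last H.
  - exact: HR.
  - by apply: CF => //; lia.
  - by rewrite size_cat /=; lia.
(* From here on [A] has size exactly [n - c], so at most [K] vertices remain. *)
have [lt_D|ge_D] := ltnP (nverts x + fsize D) K.
  have := place A (x :: D) [::]; rewrite /= cats0; apply.
  - exact: HL.
  - exact: HR.
  - by apply: CF; rewrite ?fsize_cons /= ?dx //; lia.
  - by rewrite size_cat /=; lia.
case/lastP: D => [|D w] in le_d dD KD le_ts ge_D *.
  have := place A [:: x] [::]; apply => //; first exact: HL.
  - exact: HR.
  - exact: C1.
  - by rewrite size_cat /=; lia.
move: le_d le_ts ge_D; rewrite -cats1 fsize_cat fsize_cons fsize_nil.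
rewrite size_cat /= => le_d le_ts ge_D.
move: dD KD; rewrite !all_rcons => /andP[dw dD] /andP[Kw KD].
(* At least two trees remain, of total size exactly [K]: moving the last one
   to the right of vertebra [n] leaves fewer than [K] vertices. *)
have [le_w|gt_w] := leqP (nverts w) n.
  have := place A (x :: D) [:: w]; apply.
  - exact: HL.
  - apply: (@hosts_iota_last _ _ _ _ n [::]) => //; rewrite ?fsize_nil; try by lia.
    + exact: loaded_right H.
    + by apply: (loaded_right H); lia.
  - have := nverts_gt0 w; move=> wpos.
    by apply: CF; rewrite ?fsize_cons /= ?dx //; lia.
  - by rewrite size_cat /= size_cat /=; lia.
(* Now [nverts w > n] and [K <= n.+2] force the remaining trees to be a single
   vertex [x] followed by [w].  As [A] is nonempty there are three children,
   so [d > 2] and the extra vertebra can take [x]. *)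
have xpos := nverts_gt0 x.
have /nverts1 def_x : nverts x = 1 by lia.
have def_D : D = [::].
  case: D ge_D le_ts {le_d KD dD} => // t D; rewrite fsize_cons.
  by have := nverts_gt0 t; lia.
case: (loaded_tail H) => [[d2 _]|[Q [Q' [def_tl Ql Ql']]]].
  case: A le_A lt_A le_d ge_A {dA KA le_ts} => [|a A] /=; last by lia.
  by rewrite fsize_nil; lia.
move: le_d; rewrite def_D def_x /= => le_d.
have := @lspine_place d n K UL UR tl C c (A ++ [:: leaf]) [:: w] [::].
rewrite /= -catA /=; apply=> //.
- apply: hosts_cat; first exact: HL.
  by rewrite def_tl; apply: hosts_take => //; apply: hosts_nil.
- by rewrite -[X in hosts _ _ X]cats0; apply: hosts_cat => //; apply: HR.
- by apply: C1 => //; lia.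
- by rewrite size_cat /=; lia.
Qed.

(** A root with one child needs a whole vertebra for itself, whereas siblings
    of the followed child pay for theirs; the boolean summand records the
    difference. *)
Lemma lspine_contains d n K UL UR tl C c T :
  loaded d n K UL UR tl C -> c < n -> dtree d T ->
  nverts T + (size (children T) == 1) + c <= K + n.+1 ->
  lspine d n UL UR tl C c ~>[d] T.
Proof.
move=> H; have [m] := ubnP (nverts T).
elim: m T c => // m IHm [ts] c; rewrite nvertsE /= => lt_m lt_cn dT le_T.
have [/andP[le_d dts] [K1 K2]] := (dT, andP (loaded_K H)).
have [light|[A [y [B [def_ts lt_y]]]]] := light_or_heavy K ts.
  by apply: (@lspine_light _ _ K) => //; lia.
rewrite {}def_ts in lt_m le_T le_d dts {dT} *.
rewrite fsize_cat fsize_cons in le_T lt_m.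
move: dts le_d; rewrite all_cat size_cat /= => /and3P[dA dy dB] le_d.
rewrite size_cat /= in le_T.
have sz0 us : 0 < size us -> 0 < fsize us.
  by case: us => // u us _; rewrite fsize_cons; have := nverts_gt0 u; lia.
have szA := sz0 A; have szB := sz0 B.
pose s := maxn 1 (fsize A + fsize B).
(* The [s] vertebrae used here make one vertex of [T]; when [y] is its only
   child a vertebra is still needed to form that vertex. *)
have [lt_s le_y] : c + s < n /\ nverts y + 1 + (c + s) <= K + n.+1.
  move: le_T; rewrite /s; have [E|E] /= := eqVneq (size A + (size B).+1) 1 => le_T; last by lia.
  have A0 : A = [::] by case: (A) E => // ? ? /=; lia.
  have B0 : B = [::] by case: (B) E => // ? ? /=; lia.
  by rewrite {szA szB}A0 {}B0 /= fsize_nil in le_T *; lia.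
have Hy : lspine d n UL UR tl C (c + s) ~>[d] y.
  by have b1 := leq_b1 (size (children y) == 1); apply: IHm => //; lia.
rewrite (lspine_split _ _ _ _ _ (ltnW lt_s)).
have := @vstack_contains d [seq (UL i, UR i) | i <- iota c.+1 s]
  (lspine d n UL UR tl C (c + s)) A [:: y] (rev B); rewrite revK /=; apply.
- exact: loaded_d H.
- by rewrite size_map size_iota /s; lia.
- rewrite map_fst_pairs; apply: hosts_iota => // [i ?|].
    by apply: (loaded_left H); lia.
  by rewrite /s; lia.
- rewrite map_snd_pairs; apply: hosts_iota => // [i ?||].
  + by apply: (loaded_right H); lia.
  + by rewrite all_rev.
  + by rewrite fsize_rev /s; lia.
- exact: yields1.
- by rewrite size_cat /=; lia.
Qed.

(** The edge on top provides the root when it has one child; otherwise it is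
    contracted, and the first vertebra becomes the root. *)
Lemma rooted_lspine_universal d n K UL UR tl C :
  loaded d n K UL UR tl C -> 0 < n ->
  universal_le d (K + n.+1) (Node [:: lspine d n UL UR tl C 0]).
Proof.
move=> H n_gt0 T dT le_T.
have key T' : dtree d T' -> nverts T' + (size (children T') == 1) <= K + n.+1 ->
    lspine d n UL UR tl C 0 ~>[d] T'.
  by move=> *; apply: (lspine_contains H) => //; lia.
case: T => -[|t [|t' ts]] in dT le_T *.
- by apply: (yields_forest (key leaf isT _) (l := [::]) (r := [::])); rewrite /=; lia.
- rewrite dtreeE /= in dT; case/and3P: dT => _ dt _.
  apply: (contains_below [::] [::]); apply: key => //.
  rewrite nvertsE fsize_cons fsize_nil in le_T.
  by have b1 := leq_b1 (size (children t) == 1); lia.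
- have /andP[le_d _] := dT.
  apply: contains_trans (yields_forest (key _ dT _) (l := [::]) (r := [::]) _) _.
  + by rewrite /= in le_T *; lia.
  + by rewrite /= in le_d *; lia.
  + by rewrite /= cats0; apply: contains_refl.
Qed.

(** * The trees Xi are loaded spines *)

Lemma glue_vert_center d L C R a T :
  Defs.glue (vert d L C R) (center_leaf d ++ a) T = vert d L (Defs.glue C a T) R.
Proof. by rewrite /vert /center_leaf; case: eqP. Qed.

Lemma glue_vert_left d L C R T :
  Defs.glue (vert d L C R) (left_leaf d) T = vert d T C R.
Proof. by rewrite /vert /left_leaf; case: eqP. Qed.

Lemma glue_vert_right d L C R T :
  Defs.glue (vert d L C R) (right_leaf d) T = vert d L C T.
Proof. by rewrite /vert /right_leaf; case: eqP. Qed.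

(** Addresses on the spine pass through center leaves only, so gluing below
    the first [size ps] vertebrae does not disturb them. *)
Lemma glue_vroot d ps qs C a T :
  Defs.glue (Node [:: vstack d (ps ++ qs) C]) (vroot d (size ps).+1 ++ a) T =
  Node [:: vstack d ps (Defs.glue (vstack d qs C) a T)].
Proof.
rewrite /vroot /=; congr (Node [:: _]).
by elim: ps => //= p ps IHps; rewrite -catA glue_vert_center IHps.
Qed.

Lemma vstack_cat d ps qs C : vstack d (ps ++ qs) C = vstack d ps (vstack d qs C).
Proof. exact: foldr_cat. Qed.

Lemma glue_left_vstack d ps qs i L R C T : i = (size ps).+1 ->
  glue_left d i (Node [:: vstack d (ps ++ (L, R) :: qs) C]) T =
  Node [:: vstack d (ps ++ (T, R) :: qs) C].
Proof. by move=> ->; rewrite /glue_left glue_vroot glue_vert_left vstack_cat. Qed.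

Lemma glue_right_vstack d ps qs i L R C T : i = (size ps).+1 ->
  glue_right d i (Node [:: vstack d (ps ++ (L, R) :: qs) C]) T =
  Node [:: vstack d (ps ++ (L, T) :: qs) C].
Proof. by move=> ->; rewrite /glue_right glue_vroot glue_vert_right vstack_cat. Qed.

Lemma glue_center_vstack d ps i p T : i = (size ps).+1 ->
  glue_center d i (Node [:: vstack d (ps ++ [:: p]) leaf]) T =
  Node [:: vstack d (ps ++ [:: p]) T].
Proof.
move=> ->; rewrite /glue_center glue_vroot vstack_cat /=.
by rewrite -[center_leaf d]cats0 glue_vert_center.
Qed.

Lemma spine_vstack d m :
  spine d m = Node [:: vstack d (nseq m (leaf, leaf)) leaf].
Proof.
elim: m => // m IHm.
rewrite -[LHS]/(Defs.glue (spine d m) (vroot d m.+1) (vertebra d)) {}IHm.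
rewrite -{1}(cats0 (nseq m _)).
rewrite -[in vroot d m.+1](size_nseq m (leaf, leaf)) -[vroot _ _]cats0.
rewrite glue_vroot -addn1 nseqD vstack_cat; by congr (Node [:: vstack _ _ _]).
Qed.

Lemma foldl_glue d (X : nat -> tree) n m C :
  foldl (fun T i => glue_right d i (glue_left d i T (X i)) (X i))
    (Node [:: vstack d (nseq (n + m) (leaf, leaf)) C]) (iota 1 n) =
  Node [:: vstack d ([seq (X i, X i) | i <- iota 1 n] ++ nseq m (leaf, leaf)) C].
Proof.
elim: n m => [|n IHn] m //.
rewrite -addn1 iotaD foldl_cat -addnA IHn map_cat -catA /= add1n.
by rewrite glue_left_vstack ?glue_right_vstack ?size_map ?size_iota.
Qed.

Lemma Xi_lspine d k : 3 < k ->
  Xi d k = Node [:: lspine d k./2.-1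
    (fun i => if i < k./2.-1 then Xi d i else Xi d (uphalf k).-1) (Xi d)
    (if d == 2 then [::] else [:: (Xi d (k.+1 %/ 4), Xi d (k.+1 %/ 4))])
    (Xi d (uphalf k)) 0].
Proof.
move=> k3; rewrite XiE; case: k k3 => [|[|[|[|k]]]] // _.
rewrite /Xi_step; set k' := k.+4.
have h2 : 1 < k'./2 by [].
move: (k'./2) (uphalf k') (Xi d (k'.+1 %/ 4)) h2 => h K Q h2.
rewrite spine_vstack subn2.
have [m def_m] : exists m, h = m.+2 by exists h.-2; lia.
rewrite {}def_m {h h2} /=.
have def_ps : [seq ((if i < m.+1 then Xi d i else Xi d K.-1), Xi d i)
    | i <- iota 1 m.+1] =
    [seq (Xi d i, Xi d i) | i <- iota 1 m] ++ [:: (Xi d K.-1, Xi d m.+1)].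
  rewrite -[X in iota _ X]addn1 iotaD map_cat /= add1n ltnn; congr (_ ++ _).
  by apply/eq_in_map => i; rewrite mem_iota => ?; case: ltnP => //; lia.
rewrite /lspine subn0 def_ps.
set ps := map _ (iota 1 m).
have sz : m.+1 = (size ps).+1 by rewrite size_map size_iota.
case: eqP => [d2|_].
  rewrite -addn1 foldl_glue addn1 /= -/ps cats0.
  by rewrite glue_right_vstack // glue_left_vstack // glue_center_vstack.
rewrite -addn2 foldl_glue /= -/ps -catA /=.
rewrite glue_right_vstack // glue_left_vstack //.
have sz2 : m.+2 = (size (ps ++ [:: (Xi d K.-1, Xi d m.+1)])).+1.
  by rewrite size_cat addn1 sz.
rewrite -[_ :: [:: _]]cat1s catA glue_center_vstack ?addn2 //.
by rewrite glue_left_vstack // glue_right_vstack // -catA.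
Qed.

Lemma vert_dtree d L C R : 2 <= d ->
  dtree d (vert d L C R) = [&& dtree d L, dtree d C & dtree d R].
Proof.
move=> d2; rewrite /vert; case: eqP => [->|ne2] /=.
  by rewrite !andbT andbA.
by rewrite andbT (_ : 2 < d) //; lia.
Qed.

Lemma vstack_dtree d ps C : 2 <= d ->
  dtree d (vstack d ps C) =
  dtree d C && all (fun p => dtree d p.1 && dtree d p.2) ps.
Proof.
move=> d2; elim: ps => [|p ps IHps] /=; first by rewrite andbT.
by rewrite vert_dtree // IHps; case: (dtree d p.1); case: (dtree d p.2);
  rewrite ?andbF ?andbT.
Qed.

Lemma universal_leW d m n U : m <= n -> universal_le d n U -> universal_le d m U.
Proof. by move=> le_mn HU T dT le_T; apply: HU => //; lia. Qed.

Lemma Xi_dtree d k : 2 <= d -> dtree d (Xi d k).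
Proof.
move=> d2; have [n] := ubnP k; elim: n k => // n IHn k lt_n.
have [|k3] := leqP k 3; first by case: k {lt_n} => [|[|[|[|k]]]] //= _; lia.
have Kk : uphalf k < k by lia.
have q : k.+1 %/ 4 < k by lia.
rewrite Xi_lspine //= andbT vstack_dtree // subn0 (_ : 0 < d) ?(ltnW d2) //=.
rewrite IHn ?(leq_trans Kk) //= all_cat; apply/andP; split; last first.
  by case: eqP => //= _; rewrite IHn //; lia.
rewrite all_map; apply/allP => i; rewrite mem_iota /= => i_h.
by case: ifP => _; rewrite !IHn //; lia.
Qed.

Lemma fsize_le1 ts : fsize ts <= 1 -> ts = [::] \/ ts = [:: leaf].
Proof.
case: ts => [|t [|t' ts]]; first by left.
  rewrite fsize_cons fsize_nil => le_t; right; rewrite (@nverts1 t) //.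
  by have := nverts_gt0 t; lia.
by rewrite !fsize_cons; have := nverts_gt0 t; have := nverts_gt0 t'; lia.
Qed.

Lemma universal_le_leaf1 d : universal_le d 1 leaf.
Proof.
case=> [[|t ts]] _ le_T; first exact: contains_refl.
by move: le_T; rewrite nvertsE fsize_cons; have := nverts_gt0 t; lia.
Qed.

Lemma universal_le_edge d : 0 < d -> universal_le d 2 (Node [:: leaf]).
Proof.
move=> d0 [ts] _; rewrite nvertsE ltnS => /fsize_le1[->|->].
  by apply: contains_leaf; rewrite /= d0.
exact: contains_refl.
Qed.

Lemma universal_le_cherry d : 1 < d ->
  universal_le d 3 (Node [:: Node [:: leaf; leaf]]).
Proof.
move=> d1 [ts] dT; rewrite nvertsE ltnS => le_ts.
case: ts => [|t [|t' ts]] in dT le_ts *.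
- by apply: contains_leaf; rewrite /= d1 ltnW.
- rewrite dtreeE /= in dT; case/and3P: dT => _ dt _.
  apply: (contains_below [::] [::]); rewrite fsize_cons fsize_nil addn0 in le_ts.
  apply: contains_trans (universal_le_edge (ltnW d1) dt le_ts).
  have del := yields_forest (contains_refl d leaf).
  by apply: (del [::] [:: leaf]); rewrite /=; lia.
- rewrite fsize_cons in le_ts; have tpos := nverts_gt0 t.
  have [//|[def_t' def_ts]] : t' :: ts = [::] \/ t' :: ts = [:: leaf].
    by apply: fsize_le1; lia.
  have def_t : t = leaf.
    by apply: nverts1; move: le_ts; rewrite fsize_cons; have := nverts_gt0 t'; lia.
  rewrite def_t def_t' def_ts.
  have flatten_ := yields_forest (contains_refl d (Node [:: leaf; leaf])).
  by apply: (flatten_ [::] [::]); rewrite /=; lia.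
Qed.

(** Containing all trees with at most [k] vertices, not exactly [k], is what
    the induction needs, since a vertebra hosts smaller trees too. *)
Lemma Xi_universal_le d k : 2 <= d -> 0 < k -> universal_le d k (Xi d k).
Proof.
move=> d2; have [n] := ubnP k; elim: n k => // n IHn k lt_n k0.
have [|k3] := leqP k 3.
  case: k k0 {lt_n} => [|[|[|[|k]]]] // _ _.
  - exact: universal_le_leaf1.
  - by apply: universal_le_edge; lia.
  - exact: universal_le_cherry.
apply: (@universal_leW _ _ (uphalf k + k./2.-1.+1)); first by lia.
rewrite Xi_lspine //.
apply: rooted_lspine_universal; last by lia.
split=> //.
- by lia.
- by move=> i i_h; case: ltnP => ?; [|apply: (@universal_leW _ _ (uphalf k).-1)];
    try apply: IHn; lia.
- by move=> i i_h; apply: IHn; lia.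
- by rewrite ltnn; apply: IHn; lia.
- by apply: IHn; lia.
- case: eqP => [|_]; [by left|right].
  by exists (Xi d (k.+1 %/ 4)), (Xi d (k.+1 %/ 4)); split=> //;
    apply: contains_leaf; apply: Xi_dtree.
Qed.

Lemma Nnon_le_Mprime d k : 2 <= d -> 0 < k ->
  exists2 N, is_Nnon d k N & N <= Mprime d k.
Proof.
move=> d2 k0.
have XiU : universal d k (Xi d k).
  split; first exact: Xi_dtree.
  by move=> T dT <-; apply: Xi_universal_le => //; apply: nverts_gt0.
pose P N := `[< exists2 U, universal d k U & nverts U = N >].
have PM : P (Mprime d k) by apply/asboolP; exists (Xi d k).
case: (ex_minnP (ex_intro P _ PM)) => N /asboolP HN minN.
exists N; last exact: minN.
by split=> // U HU; apply: minN; apply/asboolP; exists U.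
Qed.

(** * Counting vertices *)

Lemma nverts_vert d L C R :
  nverts (vert d L C R) = (if d == 2 then 2 else 1) + nverts L + nverts C + nverts R.
Proof. by rewrite /vert; case: eqP => _ /=; lia. Qed.

Lemma nverts_vstack d ps C :
  nverts (vstack d ps C) = (if d == 2 then 2 else 1) * size ps +
    \sum_(p <- ps) (nverts p.1 + nverts p.2) + nverts C.
Proof.
elim: ps => [|p ps IHps] /=; first by rewrite big_nil; lia.
by rewrite nverts_vert IHps big_cons; lia.
Qed.

Lemma Mprime_small d k : k <= 3 -> Mprime d k = nth 0 [:: 1; 1; 2; 4] k.
Proof. by case: k => [|[|[|[|]]]]. Qed.

Lemma Mprime_rec d k : 3 < k ->
  Mprime d k = 1 + (if d == 2 then 2 * k./2.-1 else k./2) +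
    \sum_(1 <= i < k./2.-1) (2 * Mprime d i) + Mprime d k./2.-1
    + Mprime d (uphalf k).-1 + Mprime d (uphalf k)
    + (if d == 2 then 0 else 2 * Mprime d (k.+1 %/ 4)).
Proof.
move=> k3; have h2 : 1 < k./2 by lia.
rewrite {1}/Mprime Xi_lspine //= addn0 nverts_vstack big_cat big_map /=.
rewrite subn0 size_cat size_map size_iota.
have [m ->] : exists m, k./2 = m.+2 by exists k./2.-2; lia.
rewrite (_ : m.+2.-1 = m.+1) // -[X in iota 1 X]addn1 iotaD big_cat /=.
rewrite big_seq1 add1n ltnn.
have -> : \sum_(i <- iota 1 m) (nverts (if i < m.+1 then Xi d i else
    Xi d (uphalf k).-1) + nverts (Xi d i)) = \sum_(1 <= i < m.+1) 2 * Mprime d i.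
  rewrite /index_iota subn1 /=; apply: eq_big_seq => i; rewrite mem_iota => ?.
  by rewrite ifT /Mprime; lia.
by rewrite /Mprime; case: eqP => _; rewrite ?big_nil ?big_seq1 /=; lia.
Qed.

(** The right sides supply one copy for each index below [k./2]; for [k./2]
    itself use the bottom when [k] is even and the left side of vertebra
    [k./2.-1] when [k] is odd.  The root accounts for the term at 0. *)
Lemma Mprime_half_sum d k : \sum_(0 <= i < (k./2).+1) Mprime d i <= Mprime d k.
Proof.
have [|k3] := leqP k 3.
  case: k => [|[|[|[|]]]] //= _; rewrite !big_nat_recl // big_nil !Mprime_small //.
rewrite [leqRHS]Mprime_rec //.
have [m def_m] : exists m, k./2 = m.+2 by exists k./2.-2; lia.
have : \sum_(0 <= i < m) Mprime d i.+1 <= \sum_(1 <= i < m.+1) 2 * Mprime d i.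
  by rewrite big_add1 /=; apply: leq_sum => i _; lia.
have M0 : Mprime d 0 = 1 by [].
have -> : \sum_(0 <= i < (k./2).+1) Mprime d i = 1 +
    (\sum_(0 <= i < m) Mprime d i.+1 + Mprime d m.+1 + Mprime d m.+2).
  by rewrite def_m big_nat_recl // M0 !big_nat_recr.
have [-> | ->] : uphalf k = k./2 \/ uphalf k = k./2.+1 by lia.
  by rewrite def_m /=; lia.
by rewrite def_m /=; lia.
Qed.

(** A sum of j-th powers dominates the integral of x^j. *)
Lemma exp_le_sum j n : n ^ j.+1 <= j.+1 * \sum_(0 <= i < n) i.+1 ^ j.
Proof.
elim: n => [|n IHn]; first by rewrite exp0n.
rewrite big_nat_recr //= mulnDr.
suff : n.+1 ^ j.+1 <= n ^ j.+1 + j.+1 * n.+1 ^ j by lia.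
elim: j {IHn} => [|j IHj]; first by rewrite !expn1 expn0; lia.
rewrite expnS [n ^ _]expnS.
have : n ^ j.+1 <= n.+1 ^ j.+1 by rewrite leq_exp2r.
by move: IHj; rewrite ![n.+1 ^ j.+1]expnS; nia.
Qed.

(** Iterating [Mprime_half_sum] integrates a polynomial bound of degree [j]
    over half the range, which costs a factor 2^(j+1) (j+1). *)
Lemma Mprime_lower d j k : k.+1 ^ j <= j`! * 2 ^ 'C(j.+1, 2) * Mprime d k.
Proof.
elim: j k => [|j IHj] k; first by rewrite fact0 bin_small // mul1n mul1n; apply: nverts_gt0.
have le_k : k.+1 <= 2 * k./2.+1 by lia.
have := leq_exp2r k.+1 (2 * k./2.+1) (isT : 0 < j.+1).
rewrite le_k expnMn => le1; apply: leq_trans le1 _.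
have := Mprime_half_sum d k; have := exp_le_sum j k./2.+1.
set h := k./2.+1; set S := \sum_(0 <= i < h) _ ^ _ => le2 le3.
have le4 : S <= j`! * 2 ^ 'C(j.+1, 2) * \sum_(0 <= i < h) Mprime d i.
  by rewrite big_distrr; apply: leq_sum.
rewrite factS binS bin1 [in X in _ <= X]expnD.
move: (j`!) (2 ^ 'C(j.+1, 2)) (2 ^ j.+1) le4 le3 le2 => F B P le4 le3 le2.
have le5 : S <= F * B * Mprime d k by apply: leq_trans le4 _; rewrite leq_mul2l le3 orbT.
have le6 := leq_trans le2 (leq_mul (leqnn j.+1) le5).
by apply: leq_trans (leq_mul (leqnn P) le6) _; lia.
Qed.

(** For [k] up to 2^(j+1) there are about 2 * 2^j copies, all with index at most
    2^j, and at most about as many further vertices; a factor 2^(j+3) covers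
    both. *)
Lemma Mprime_upper d j k : k <= 2 ^ j -> Mprime d k <= 2 ^ ('C(j, 2) + 3 * j).
Proof.
elim: j k => [|j IHj] k; first by case: k => [|[]].
rewrite expnS => le_k; have [k3|k3] := leqP k 3.
  rewrite Mprime_small //; apply: (@leq_trans (2 ^ 2)).
    by case: k k3 {le_k} => [|[|[|[|]]]].
  by rewrite leq_exp2l //; lia.
rewrite Mprime_rec //; set w := (X in _ + X); set v := (X in 1 + X).
set B := 2 ^ ('C(j, 2) + 3 * j).
have IH i : i <= 2 ^ j -> Mprime d i <= B by apply: IHj.
have le_w : w <= 2 * B.
  by rewrite /w; case: eqP => // _; rewrite leq_pmul2l //; apply: IH; lia.
have le_v : v <= k by rewrite /v; case: eqP => _; lia.
have B0 : 0 < B by rewrite expn_gt0.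
have le_S : \sum_(1 <= i < k./2.-1) (2 * Mprime d i) <= (k./2.-1 - 1) * (2 * B).
  rewrite -sum_nat_const_nat big_nat_cond [leqRHS]big_nat_cond; apply: leq_sum => i.
  by rewrite andbT => ?; rewrite leq_pmul2l // IH //; lia.
have /IH : k./2.-1 <= 2 ^ j by lia.
have /IH : (uphalf k).-1 <= 2 ^ j by lia.
have /IH : uphalf k <= 2 ^ j by lia.
clearbody v w; move=> *; apply: (@leq_trans (2 ^ j * 8 * B)).
  have : k./2 <= 2 ^ j by lia.
  have : 2 <= k./2 by lia.
  have : k <= 2 * k./2 + 1 by lia.
  move: (2 ^ j) => N; nia.
by rewrite /B binS bin1 (_ : 8 = 2 ^ 3) // -!expnD leq_exp2l //; lia.
Qed.

(** * Asymptotics *)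

Lemma fact_le_exp n : n`! <= n ^ n.
Proof.
elim: n => // -[|n] IHn //; rewrite factS expnS leq_mul2l /=.
by apply: leq_trans IHn _; rewrite leq_exp2r.
Qed.

Local Open Scope ring_scope.

Import Order.TTheory GRing.Theory Num.Theory.

(** Any positive constant lower bound would serve; it turns an error linear in
    [ln 2] into one quadratic in it. *)
Lemma ln2_ge_half (R : realType) : 2^-1 <= ln 2 :> R.
Proof.
have := @le_ln1Dx R (- 2^-1); rewrite (_ : 1 + - 2^-1 = 2^-1); last by lra.
by rewrite lnV ?posrE // => le; rewrite -lerN2; apply: le; lra.
Qed.

Lemma ln_exp2n (R : realType) n : ln ((2 ^ n)%N%:R : R) = n%:R * ln 2.
Proof. by rewrite natrX lnXn // mulr_natl. Qed.

Lemma ln_natr_le (R : realType) (m n : nat) : (0 < m)%N -> (m <= n)%N ->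
  ln (m%:R : R) <= ln n%:R.
Proof. by move=> m0 le_mn; rewrite ler_ln ?posrE ?ltr0n ?ler_nat //; lia. Qed.

Lemma bin2_natr (R : realType) n : ('C(n.+1, 2))%:R = (n%:R + 1) * n%:R / 2 :> R.
Proof.
have := mul_bin_diag n.+1 1; rewrite /= bin1 => /(congr1 (GRing.natmul (1 : R))).
by rewrite !natrM -natr1 => eq; lra.
Qed.

Lemma ln_Mprime_ge (R : realType) d k (l := trunc_log 2 k) : (1 < k)%N ->
  l%:R ^+ 2 * ln 2 - l%:R * ln l%:R - (l%:R + 1) * l%:R / 2 * ln 2
    <= ln ((Mprime d k)%:R : R).
Proof.
move=> k1; have l0 : (0 < l)%N by rewrite trunc_log_gt0.
have M0 : (0 < Mprime d k)%N by apply: nverts_gt0.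
have le : (2 ^ (l * l) <= l ^ l * 2 ^ 'C(l.+1, 2) * Mprime d k)%N.
  rewrite expnM; apply: (@leq_trans (k.+1 ^ l)).
    rewrite leq_exp2r //; apply: leqW; apply: trunc_logP => //; lia.
  by apply: leq_trans (Mprime_lower d l k) _; rewrite !leq_mul2r fact_le_exp !orbT.
have := ln_natr_le R _ le; rewrite expn_gt0 => /(_ isT).
rewrite ln_exp2n !natrM !lnM ?posrE ?mulr_gt0 ?ltr0n ?expn_gt0 ?l0 //.
rewrite ln_exp2n bin2_natr natrX lnXn ?ltr0n // -[ln _ *+ _]mulr_natl expr2.
by lra.
Qed.

Lemma ln_Mprime_le (R : realType) d k (l := trunc_log 2 k) :
  ln ((Mprime d k)%:R : R) <= ((l%:R + 1) * l%:R / 2 + 3 * (l%:R + 1)) * ln 2.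
Proof.
have M0 : (0 < Mprime d k)%N by apply: nverts_gt0.
have /Mprime_upper -/(_ d) le : (k <= 2 ^ l.+1)%N by apply/ltnW/trunc_log_ltn.
have := ln_natr_le R M0 le.
by rewrite ln_exp2n natrD natrM bin2_natr natr1.
Qed.

(** Here [x = ln k], [y = ln (Mprime d k)], [t = ln 2], [a] is the integer part
    of log2 k and [s] its square root.  The term [2 * s] bounds [ln a], which
    comes from j!; a bound of order [s] is enough, as dividing by [a] still
    gives an error tending to 0. *)
Lemma error_bound (R : realType) (x y a s t : R) :
  2^-1 <= t -> 1 <= s -> a = s ^+ 2 -> a * t <= x <= (a + 1) * t ->
  a ^+ 2 * t - a * (2 * s) - (a + 1) * a / 2 * t <= y ->
  y <= ((a + 1) * a / 2 + 3 * (a + 1)) * t ->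
  `|2 * t * y / x ^+ 2 - 1| <= 13 / s.
Proof.
move=> t_ge s_ge def_a /andP[x_ge x_le] y_ge y_le.
have s0 : 0 < s by lra.
have t0 : 0 < t by lra.
have a1 : 1 <= a by rewrite def_a; nra.
have x0 : 0 < x by apply: lt_le_trans x_ge; rewrite mulr_gt0 //; lra.
have sq_ge : (a * t) ^+ 2 <= x ^+ 2 by rewrite ler_sqr ?nnegrE; nra.
have sq_le : x ^+ 2 <= ((a + 1) * t) ^+ 2 by rewrite ler_sqr ?nnegrE; nra.
have as_ge : a <= a * s by nra.
have tt : 0 < t ^+ 2 by rewrite exprn_gt0.
have tt2 : t <= 2 * t ^+ 2 by rewrite expr2; nra.
suff main : `|2 * t * y - x ^+ 2| <= 13 * (a * s) * t ^+ 2.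
  rewrite -[X in _ - X](@divff _ (x ^+ 2)) ?expf_neq0 ?gt_eqF // -mulrBl.
  rewrite normrM normfV (ger0_norm (sqr_ge0 x)) ler_pdivrMr ?exprn_gt0 //.
  apply: le_trans main _; rewrite [leRHS]mulrAC ler_pdivlMr //.
  have -> : 13 * (a * s) * t ^+ 2 * s = 13 * (a * t) ^+ 2.
    by rewrite def_a; ring.
  by rewrite ler_pM2l //; lra.
have ub : 2 * t * y <= (a ^+ 2 + 7 * a + 6) * t ^+ 2.
  have -> : (a ^+ 2 + 7 * a + 6) * t ^+ 2 =
    2 * t * (((a + 1) * a / 2 + 3 * (a + 1)) * t) by field.
  by rewrite ler_pM2l // mulr_gt0.
have lb : (a ^+ 2 - a) * t ^+ 2 - 4 * (a * s) * t <= 2 * t * y.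
  have -> : (a ^+ 2 - a) * t ^+ 2 - 4 * (a * s) * t =
    2 * t * (a ^+ 2 * t - a * (2 * s) - (a + 1) * a / 2 * t) by field.
  by rewrite ler_pM2l // mulr_gt0.
have e1 : 4 * (a * s) * t <= 8 * (a * s) * t ^+ 2.
  rewrite (_ : 8 * (a * s) * t ^+ 2 = 4 * (a * s) * (2 * t ^+ 2)); last by ring.
  by rewrite ler_wpM2l // !mulr_ge0 //; lra.
have e2 : a * t ^+ 2 <= a * s * t ^+ 2 by rewrite ler_pM2r.
have e3 : t ^+ 2 <= a * s * t ^+ 2.
  by rewrite -[leLHS]mul1r ler_pM2r //; lra.
rewrite !exprMn in sq_ge sq_le.
by rewrite ler_norml; apply/andP; split; lra.
Qed.

Lemma Mprime_error (R : realType) d k : (1 < k)%N ->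
  `|2 * ln 2 * ln (Mprime d k)%:R / ln (k%:R : R) ^+ 2 - 1|
    <= 13 / Num.sqrt (trunc_log 2 k)%:R.
Proof.
move=> k1; have k0 : (0 < k)%N by lia.
set l := trunc_log 2 k; have l0 : (0 < l)%N by rewrite trunc_log_gt0.
have l1 : 1 <= l%:R :> R by rewrite ler1n.
set s := Num.sqrt l%:R.
have s1 : 1 <= s by rewrite -sqrtr1 ler_sqrt //; lra.
have def_l : l%:R = s ^+ 2 by rewrite sqr_sqrtr.
apply: (@error_bound _ _ _ l%:R) => //.
- exact: ln2_ge_half.
- rewrite -ln_exp2n natr1 -ln_exp2n !ln_natr_le ?expn_gt0 //.
    exact/ltnW/trunc_log_ltn.
  exact: trunc_logP.
- apply: le_trans (ln_Mprime_ge R d k1); rewrite -/l.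
  have ln_l : ln l%:R <= 2 * s.
    rewrite def_l lnXn; last by lra.
    by rewrite -[ln s *+ 2]mulr_natl ler_pM2l // ltW // ln_sublinear //; lra.
  have : l%:R * ln l%:R <= l%:R * (2 * s) by rewrite ler_wpM2l //; lra.
  by lra.
- exact: ln_Mprime_le.
Qed.

Lemma error_cvg0 (R : realType) (o : nat -> R) (C : R) :
  0 < C ->
  (forall k, (1 < k)%N -> `|o k| <= C / Num.sqrt (trunc_log 2 k)%:R) ->
  (o @ \oo --> (0 : R))%classic.
Proof.
move=> C0 Ho; apply/cvgr0Pnorm_lt => e e0.
pose N := (Num.truncn ((C / e) ^+ 2)).+1.
exists (2 ^ N)%N => // k /= le_k.
have k1 : (1 < k)%N by apply: leq_trans le_k; rewrite expnS; have := expn_gt0 2 N.-1; lia.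
apply: le_lt_trans (Ho k k1) _.
have le_N : (N <= trunc_log 2 k)%N by apply: trunc_log_max.
have lt_l : (C / e) ^+ 2 < (trunc_log 2 k)%:R.
  by apply: lt_le_trans (truncnS_gt _) _; rewrite ler_nat.
have Ce : 0 < C / e by rewrite divr_gt0.
have lt_s : C / e < Num.sqrt (trunc_log 2 k)%:R.
  by rewrite -[ltLHS]ger0_norm ?(ltW Ce) // -sqrtr_sqr ltr_sqrt // (le_lt_trans _ lt_l) // sqr_ge0.
rewrite ltr_pdivrMr; last exact: lt_trans lt_s.
by rewrite mulrC -ltr_pdivrMr.
Qed.

(** The exponent is chosen by solving for o(1); for [k = 1] both sides are 1
    whatever it is. *)
Lemma Mprime_powR (R : realType) d k (L := ln (k%:R : R)) : (0 < k)%N ->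
  (Mprime d k)%:R = k%:R `^ (2^-1 * log2 (k%:R : R) *
     (1 + (2 * ln 2 * ln (Mprime d k)%:R / L ^+ 2 - 1))).
Proof.
move=> k0; have [k1|k1] := leqP k 1.
  by rewrite (_ : k = 1%N) ?powR1 //; lia.
have M0 : (0 < Mprime d k)%N by apply: nverts_gt0.
have ln2 : 0 < ln 2 :> R by have := ln2_ge_half R; lra.
have L0 : 0 < L by rewrite ln_gt0 // ltr1n.
rewrite /powR pnatr_eq0 eqn0Ngt k0 /= /log2 -/L.
rewrite (_ : _ * L = ln (Mprime d k)%:R); first by rewrite lnK // posrE ltr0n.
by field; rewrite !gt_eqF.
Qed.

Local Open Scope classical_set_scope.
Local Open Scope ring_scope.

Theorem corollary3p8 (R : realType) (d : nat) (hd : (2 <= d)%N) :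
  (forall k : nat, (1 <= k)%N ->
     exists2 N : nat, is_Nnon d k N & (N <= Mprime d k)%N) /\
  (exists2 o : nat -> R,
     o @ \oo --> (0 : R) &
     forall k : nat, (1 <= k)%N ->
       (Mprime d k)%:R = k%:R `^ (2^-1 * log2 (k%:R : R) * (1 + o k))).
Proof.
split; first by move=> k k0; apply: Nnon_le_Mprime.
exists (fun k => 2 * ln 2 * ln (Mprime d k)%:R / ln (k%:R : R) ^+ 2 - 1).
  by apply: (@error_cvg0 _ _ 13) => // k k1; apply: Mprime_error.
by move=> k k0; apply: Mprime_powR.
Qed.
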